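(* Almost every graph admits an antimagic orientation; that is, if $P(n)$ denotes the probability that the random graph $G(n,1/2)$ on $n$ vertices admits an antimagic orientation, then $P(n)\to 1$ as $n\to\infty$.
   Context: $G(n,1/2)$ is the random simple graph on $n$ labeled vertices in which each pair of vertices is adjacent independently with probability $1/2$ (equivalently, all graphs on the $n$ vertices are equally likely). A graph $G$ admits an antimagic orientation if there exist an orientation $D$ of $E(G)$ and a bijection $\tau: E(G)\to\{1,2,\ldots,|E(G)|\}$ such that the vertex sums of all vertices are pairwise distinct, where the vertex sum of $v$ is the sum of the labels of edges directed into $v$ minus the sum of the labels of edges directed out of $v$. *)

(* Defs.v *)
From HB Require Import structures.
From mathcomp Require Import all_boot all_order all_algebra.
From mathcomp Require Import all_classical all_reals all_analysis.

Set Implicit Arguments.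
Unset Strict Implicit.
Unset Printing Implicit Defensive.

Import Order.TTheory GRing.Theory Num.Theory.
Import numFieldNormedType.Exports.

Local Open Scope ring_scope.

Section Graphs.
Variable T : finType.

Definition vpairs : {set {set T}} := [set e : {set T} | #|e| == 2%N]%SET.

(* A simple graph on the vertex set T, given by its edge set. *)
Definition sgraph := {E : {set {set T}} | E \subset vpairs}.

Definition edges (G : sgraph) : {set {set T}} := val G.

(* D u v stands for the arc u -> v: every arc lies on an edge, and every edge
   carries exactly one of its two possible arcs. *)
Definition orientation (G : sgraph) (D : rel T) : Prop :=
  (forall u v, D u v -> [set u; v]%SET \in edges G) /\
  (forall u v, [set u; v]%SET \in edges G -> D u v (+) D v u).

(* The values of tau outside the edge set are irrelevant. *)
Definition edge_labeling (G : sgraph) (tau : {set T} -> nat) : Prop :=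
  set_bij [set` edges G]%classic
          [set k : nat | (1 <= k <= #|edges G|)%N]%classic tau.

Definition vertex_sum (D : rel T) (tau : {set T} -> nat) (v : T) : int :=
  \sum_(u | D u v) (tau [set u; v]%SET)%:Z -
  \sum_(u | D v u) (tau [set v; u]%SET)%:Z.

Definition antimagic_orientation (G : sgraph) : Prop :=
  exists (D : rel T) (tau : {set T} -> nat),
    [/\ orientation G D, edge_labeling G tau & injective (vertex_sum D tau)].

End Graphs.

(* G(n, p): each pair of vertices is an edge independently with probability p,
   so a graph has the product of the weights of its pairs as probability. *)
Definition gnp_mass (R : realType) (n : nat) (p : R) (G : sgraph 'I_n) : R :=
  \prod_(e in vpairs 'I_n) (if e \in edges G then p else 1 - p).

Definition gnp_prob (R : realType) (n : nat) (p : R)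
    (A : sgraph 'I_n -> Prop) : R :=
  \sum_(G : sgraph 'I_n | `[< A G >]) gnp_mass p G.

(* Main.v *)
Require Import Defs.
From HB Require Import structures.
From mathcomp Require Import all_boot all_order all_algebra.
From mathcomp Require Import zify ring lra.
Import Order.TTheory GRing.Theory Num.Theory.

Set Implicit Arguments.
Unset Strict Implicit.
Unset Printing Implicit Defensive.

Local Open Scope ring_scope.

(** Fix a vertex x0 and a set Z of O(log n) other vertices; let X be the set of
    neighbours of x0 in Z and Y the set of remaining vertices. With high
    probability X dominates Y, the vertices of X and x0 have almost n/2
    neighbours in Y, and there are about n^2/4 edges.

    Orient X -> Y -> x0 -> X. The h edges inside Y get the labels 1..h and are
    oriented greedily, which keeps the sum of the squares of the partial vertex
    sums below 2 * (1^2 + ... + h^2), hence each of them below about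
    h * sqrt(2h/3) ~ 0.41 n h. The edges between Y and X or x0 have larger
    labels than h, so the vertices of X have sums below about -0.5 n h, and x0
    has a sum above 0.5 n h: the three classes are separated.

    Inside Y the sums are made distinct by reserving for each y one edge to X,
    and giving the reserved edges consecutive labels in the order of the sums of
    the other labels at y. The edges from x0 to X, which receive the largest
    labels, do the same for X. *)

(** * Greedy orientation *)

Definition arc_sign {T : finType} (D : rel T) (u v : T) : int := (D u v)%:Z - (D v u)%:Z.

Lemma vertex_sumE {T : finType} (D : rel T) (tau : {set T} -> nat) (v : T) :
  vertex_sum D tau v = \sum_u arc_sign D u v * (tau [set u; v])%:Z.
Proof.
rewrite /vertex_sum [X in X - _]big_mkcond [X in _ - X]big_mkcond -sumrB.
apply: eq_bigr => u _; rewrite /arc_sign (setUC [set v]).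
by case: (D u v); case: (D v u); rewrite /= ?subrr ?mul0r ?subr0 ?sub0r ?mul1r ?mulN1r.
Qed.

Lemma eq_set2 (T : finType) (a b u v : T) : a != b ->
  ([set u; v] == [set a; b]) = (u == a) && (v == b) || (u == b) && (v == a).
Proof.
move=> ab; apply/eqP/idP => [E|/orP[]/andP[/eqP-> /eqP->] //]; last by rewrite setUC.
have := set21 a b; have := set22 a b; rewrite -E !inE.
case/orP=> /eqP eb; case/orP=> /eqP ea; rewrite -?ea -?eb ?eqxx ?orbT //;
by move: ab; rewrite ea eb eqxx.
Qed.

(** The edges are oriented one at a time, each from the endpoint with the larger current sum [w a]
    to the one with the smaller sum [w b]. An edge with label [t] changes the sum of squares by
    [2 * t * (w b - w a) + 2 * t ^+ 2], and the first term is at most 0. *)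
Lemma balanced_orientation (T : finType) (tau : {set T} -> nat) (s : seq {set T}) :
    uniq s -> {in s, forall e : {set T}, #|e| = 2%N} ->
  exists D : rel T,
    [/\ forall u v, D u v -> [set u; v] \in s,
        forall u v, [set u; v] \in s -> D u v (+) D v u &
        \sum_v vertex_sum D tau v ^+ 2 <= 2 * \sum_(e <- s) (tau e)%:Z ^+ 2].
Proof.
elim: s => [_ _|e s IHs /= /andP[es us] card2].
  exists (fun _ _ => false); split => //.
  rewrite big_nil mulr0 big1 // => v _; by rewrite vertex_sumE big1.
have [|D [Ds sD sumD]] := IHs us; first by move=> f fs; apply: card2; rewrite inE fs orbT.
have /eqP/cards2P[a [b [ab Ee]]] : #|e| = 2%N by apply: card2; rewrite inE eqxx.
wlog le_ba : a b ab Ee / vertex_sum D tau b <= vertex_sum D tau a.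
  move=> W; have [|/ltW] := leP (vertex_sum D tau b) (vertex_sum D tau a).
    exact: W ab Ee.
  by apply: W; rewrite 1?eq_sym // setUC.
have Dab : D a b = false by apply/negP => /Ds; rewrite -Ee (negbTE es).
have Dba : D b a = false by apply/negP => /Ds; rewrite setUC -Ee (negbTE es).
exists (fun u v => D u v || ((u == a) && (v == b))); split.
- move=> u v /orP[/Ds uv|/andP[/eqP-> /eqP->]]; first by rewrite inE uv orbT.
  by rewrite inE -Ee eqxx.
- move=> u v; rewrite inE => /orP[|/[dup] uvs /sD].
    rewrite Ee eq_set2 // => /orP[] /andP[/eqP-> /eqP->];
    by rewrite !eqxx Dab Dba /= (negbTE ab) ?andbF //= eq_sym (negbTE ab).
  have : [set u; v] != e by apply: contraNneq es => <-.
  rewrite Ee eq_set2 // negb_or (andbC (v == a)) => /andP[/negbTE-> /negbTE->].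
  by rewrite !orbF.
have vsE v : vertex_sum (fun u v => D u v || ((u == a) && (v == b))) tau v =
   vertex_sum D tau v + (tau e)%:Z * ((v == b)%:Z - (v == a)%:Z).
  rewrite !vertex_sumE.
  under eq_bigr => u _.
    have -> : arc_sign (fun u v => D u v || ((u == a) && (v == b))) u v =
       arc_sign D u v + ((u == a) && (v == b))%:Z - ((u == b) && (v == a))%:Z.
      rewrite /arc_sign [(v == a) && _]andbC.
      have [/andP[/eqP-> /eqP->]|_] := boolP ((u == a) && (v == b)).
        by rewrite Dab Dba (negbTE ab).
      have [/andP[/eqP-> /eqP->]|_] := boolP ((u == b) && (v == a)).
        by rewrite Dab Dba.
      by rewrite !orbF addr0 subr0.
    rewrite mulrBl mulrDl; over.
  rewrite sumrB big_split /= -addrA; congr (_ + _).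
  rewrite mulrBr; congr (_ - _).
    rewrite (bigD1 a) //= big1 => [|u /negbTE->]; last by rewrite mul0r.
    by rewrite eqxx addr0 /= Ee mulrC; case: eqP => [->//|]; rewrite !mulr0.
  rewrite (bigD1 b) //= big1 => [|u /negbTE->]; last by rewrite mul0r.
  by rewrite eqxx addr0 /= Ee mulrC; case: eqP => [->|]; rewrite ?mulr0 // setUC.
under eq_bigr do rewrite vsE.
move: (vertex_sum D tau) le_ba sumD {vsE} => w le_ba sumD; set t := (tau e)%:Z.
have -> : \sum_v (w v + t * ((v == b)%:Z - (v == a)%:Z)) ^+ 2 =
    \sum_v w v ^+ 2 + 2 * t * (w b - w a) + 2 * t ^+ 2.
  under eq_bigr => v _.
    rewrite (_ : _ ^+ 2 = w v ^+ 2 + ((v == b)%:Z * (2 * t * w v + t ^+ 2) +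
       (v == a)%:Z * (t ^+ 2 - 2 * t * w v))); last first.
      case: (v =P b) => [->|_]; last by case: (v == a) => /=; ring.
      by rewrite eq_sym (negbTE ab) /=; ring.
    over.
  rewrite !big_split /= -!addrA; congr (_ + _).
  rewrite (bigD1 b) //= big1 => [|u /negbTE->]; last by rewrite mul0r.
  rewrite (bigD1 a) //= [X in _ + (_ + X) = _]big1 => [|u /negbTE->]; last by rewrite mul0r.
  by rewrite !eqxx /=; ring.
have dlt : 2 * t * (w b - w a) <= 0 by rewrite mulr_ge0_le0 ?mulr_ge0 // subr_le0.
rewrite big_cons [leRHS]mulrDr [leRHS]addrC -/t.
by rewrite lerD2r -[leRHS]addr0 lerD.
Qed.

(** * The hub construction *)

Lemma arc_signC {T : finType} (D : rel T) (u v : T) : arc_sign D u v = - arc_sign D v u.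
Proof. by rewrite /arc_sign opprB. Qed.

Lemma arc_sign_norm {T : finType} (D : rel T) (u v : T) : `|arc_sign D u v| <= 1.
Proof. by rewrite /arc_sign; case: (D u v); case: (D v u). Qed.

(** Along the sorted list [w] does not decrease and the index strictly increases, so their sum
    strictly increases. This is how consecutive labels on reserved edges make vertex sums
    distinct. *)
Lemma index_sort_inj {T : eqType} (w : T -> int) (s : seq T) :
  {in s &, injective (fun y => w y + (index y (sort (fun a b => w a <= w b) s))%:Z)}.
Proof.
set r := sort _ s => y z ys zs /= Eyz.
have yr : y \in r by rewrite mem_sort.
have zr : z \in r by rewrite mem_sort.
have sr : sorted (fun a b => w a <= w b) r by apply: sort_sorted => a b; apply: le_total.
have tr : transitive (fun a b => w a <= w b) by move=> a b c; apply: le_trans.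
have [lt|lt|eq] := ltngtP (index y r) (index z r).
- by have := sorted_ltn_index tr sr _ _ yr zr lt; lia.
- by have := sorted_ltn_index tr sr _ _ zr yr lt; lia.
- by rewrite -(nth_index y yr) eq nth_index.
Qed.

Lemma index_map_in {T1 T2 : eqType} (f : T1 -> T2) (s : seq T1) (x : T1) :
  {in s &, injective f} -> x \in s -> index (f x) (map f s) = index x s.
Proof.
elim: s => //= a s IHs injf xas; rewrite (inj_in_eq injf) ?mem_head //.
case: (a =P x) xas => [//|/eqP ax]; rewrite inE eq_sym (negbTE ax) /= => xs.
by rewrite IHs // => u v us vs; apply: injf; rewrite inE ?us ?vs orbT.
Qed.

Lemma index_edge_labeling {T : finType} (G : sgraph T) (s : seq {set T}) :
  uniq s -> s =i edges G -> edge_labeling G (fun e => (index e s).+1).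
Proof.
move=> us sE; have size_s : size s = #|edges G|.
  by rewrite -(card_uniqP us); apply: eq_card.
split=> [e|e f|k].
- by rewrite /= -sE -size_s -index_mem.
- rewrite !classical_sets.in_setE /= -!sE => es fs [] ef.
  by rewrite -(nth_index set0 es) ef nth_index.
- rewrite /= -size_s; case: k => // k ks.
  exists (nth set0 s k); first by rewrite /= -sE mem_nth.
  by rewrite index_uniq.
Qed.

Section HubConstruction.
Variables (T : finType) (G : sgraph T) (x0 : T) (X : {set T}) (p : T -> T).
Variables (d b : nat).
Notation E := (edges G).
Let Y := ~: (x0 |: X).
Let EY := [set e in E | e \subset Y].
Let h := #|EY|.
Hypothesis x0X : x0 \notin X.
Hypothesis hubX : forall x, x \in X -> [set x; x0] \in E.
Hypothesis pX : forall y, y \in Y -> p y \in X.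
Hypothesis pE : forall y, y \in Y -> [set y; p y] \in E.
Hypothesis degY : forall x, x \in x0 |: X -> (d <= #|[set y in Y | [set x; y] \in E]|)%N.
(** By the bound of [balanced_orientation], [b] then dominates every partial sum that comes from the
    edges inside [Y]. *)
Hypothesis b_large : (2 * \sum_(i < h) i.+1 ^ 2 <= b ^ 2)%N.
(** The sums will lie below [(#|X| + 1) * #|E| - d * h] on [X], between [- b - #|E|] and
    [b + #|X| * #|E|] on [Y], and above [d * h - #|X| * #|E|] at [x0]; this inequality makes the
    three ranges disjoint. *)
Hypothesis gap : (b + (2 * #|X| + 2) * #|E| < d * h)%N.

(* Reserved edges, one for each vertex of [Y] and of [X]. *)
Let priv y := [set y; p y].
Let hub x := [set x; x0].
Let P := priv @: Y.
Let R := hub @: X.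
(** Labels are positions in a list of edges. With [EY] in front, the edges inside [Y] receive 1 to
    [h] and all others receive more. *)
Let s0 := enum EY ++ enum (E :\: EY :\: P :\: R).
Let tau0 e := (index e s0).+1.

Let inY y : (y \in Y) = (y != x0) && (y \notin X).
Proof. by rewrite !inE negb_or. Qed.

Let card_edge e : e \in E -> #|e| = 2%N.
Proof. by move=> eE; have /subsetP/(_ _ eE) := valP G; rewrite inE => /eqP. Qed.

Let edge_neq u v : [set u; v] \in E -> u != v.
Proof. by move/card_edge; rewrite cards2; case: eqP. Qed.

Let YNX y : y \in Y -> (y \in X) = false.
Proof. by rewrite inY => /andP[_ /negbTE]. Qed.
Let YNx0 y : y \in Y -> (y == x0) = false.
Proof. by rewrite inY => /andP[/negbTE]. Qed.
Let XNx0 x : x \in X -> (x == x0) = false.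
Proof. by move=> xX; apply: contraNF x0X => /eqP <-. Qed.
Let XNY x : x \in X -> (x \in Y) = false.
Proof. by move=> xX; rewrite inY xX andbF. Qed.
Let x0NY : (x0 \in Y) = false.
Proof. by rewrite inY eqxx. Qed.

(** A reserved edge in [P] has exactly one end in [Y], so at [y] there is no other than its own. *)
Let privN u y : y \in Y -> u != p y -> [set u; y] \notin P.
Proof.
move=> yY uy; apply/imsetP => -[z zY /eqP]; rewrite /priv eq_set2; last first.
  by apply: contraTneq (zY) => ->; rewrite XNY ?pX.
case/orP=> /andP[/eqP e1 /eqP e2]; last by rewrite e1 e2 eqxx in uy.
by move: yY; rewrite e2 XNY // pX.
Qed.

Let hubNY u y : y \in Y -> [set u; y] \notin R.
Proof.
move=> yY; apply/imsetP => -[z zX /eqP]; rewrite /hub (eq_set2 _ _ (negbT (XNx0 zX))).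
by case/orP=> /andP[_ /eqP e2]; move: yY; rewrite e2 ?x0NY ?XNY.
Qed.

Let hubNX u x : x \in X -> u != x0 -> [set u; x] \notin R.
Proof.
move=> xX ux; apply/imsetP => -[z zX /eqP]; rewrite /hub (eq_set2 _ _ (negbT (XNx0 zX))).
by case/orP=> /andP[/eqP e1 /eqP e2]; [rewrite e2 (negbTE x0X) in xX|rewrite e1 eqxx in ux].
Qed.

Let P_E e : e \in P -> e \in E.
Proof. by case/imsetP => y yY ->; apply: pE. Qed.
Let R_E e : e \in R -> e \in E.
Proof. by case/imsetP => x xX ->; apply: hubX. Qed.
Let P_R e : e \in P -> e \notin R.
Proof. by case/imsetP => y yY ->; rewrite /priv setUC hubNY. Qed.
Let P_EY e : e \in P -> e \notin EY.
Proof.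
case/imsetP => y yY ->; rewrite inE; apply/negP => /andP[_ /subsetP/(_ (p y))].
by rewrite set22 XNY ?pX // => /(_ isT).
Qed.
Let R_EY e : e \in R -> e \notin EY.
Proof.
case/imsetP => y yY ->; rewrite inE; apply/negP => /andP[_ /subsetP/(_ x0)].
by rewrite set22 x0NY => /(_ isT).
Qed.

Let mem_s0 e : (e \in s0) = [&& e \in E, e \notin P & e \notin R].
Proof.
rewrite mem_cat !mem_enum !in_setD.
have [eY|eY] := boolP (e \in EY); last by rewrite /= andbA [RHS]andbC [_ && (e \notin P)]andbC.
have := eY; rewrite inE => /andP[-> _] /=.
by rewrite (contraL (@P_EY e)) ?(contraL (@R_EY e)).
Qed.

Let uniq_s0 : uniq s0.
Proof.
rewrite cat_uniq !enum_uniq andbT /=; apply/hasPn => e.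
by rewrite !mem_enum !in_setD => /and4P[].
Qed.

Let sum_tau0 : (\sum_(e <- enum EY) (tau0 e)%:Z ^+ 2 = (\sum_(i < h) i.+1 ^ 2)%N%:Z).
Proof.
rewrite (big_nth set0) big_mkord -cardE /h -natz natr_sum.
apply: eq_bigr => i _; by rewrite natz /tau0 index_cat mem_nth -?cardE // index_uniq ?enum_uniq -?cardE.
Qed.

Variable DH : rel T.
Hypothesis DH_EY : forall u v, DH u v -> [set u; v] \in enum EY.
Hypothesis EY_DH : forall u v, [set u; v] \in enum EY -> DH u v (+) DH v u.
Hypothesis DH_sum : \sum_v vertex_sum DH tau0 v ^+ 2 <= 2 * \sum_(e <- enum EY) (tau0 e)%:Z ^+ 2.

(** Inside [X] the orientation is arbitrary, here along the enumeration: these edges contribute at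
    most [#|X| * #|E|] to any sum. *)
Let D u v := ([set u; v] \in E) &&
  (if (u \in Y) && (v \in Y) then DH u v
   else if (u \in X) && (v \in X) then (enum_rank u < enum_rank v)%N
   else [|| (u \in X) && (v \in Y), (u \in Y) && (v == x0) | (u == x0) && (v \in X)]).

(** The sum at [y] without its reserved edge. All other edges at [y] lie in [s0], so this is known
    before the reserved edges are labeled, and sorting by it is not circular. In the same way [w1]
    below involves only labels fixed by [s1]. *)
Let w0 y := \sum_(u | u != p y) arc_sign D u y * (tau0 [set u; y])%:Z.
Let sP := sort (fun a b => w0 a <= w0 b) (enum Y).
Let s1 := s0 ++ map priv sP.
Let tau1 e := (index e s1).+1.
Let w1 x := \sum_(u | u != x0) arc_sign D u x * (tau1 [set u; x])%:Z.
Let sR := sort (fun a b => w1 a <= w1 b) (enum X).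
Let s2 := s1 ++ map hub sR.
Let tau e := (index e s2).+1.

Let VP v : [\/ v = x0, v \in X | v \in Y].
Proof.
rewrite inY; case: (v =P x0) => [|_]; first by constructor 1.
by case: (boolP (v \in X)) => _; [constructor 2 | constructor 3].
Qed.

Let orientationD : orientation G D.
Proof.
split=> [u v /andP[]//|u v uv].
have uNv := edge_neq uv; rewrite /D [in D in _ (+) D](setUC [set v]) uv /=.
have [uX|uX|uX] := VP u; have [vX|vX|vX] := VP v;
  rewrite ?uX ?vX ?eqxx ?(YNX uX) ?(YNX vX) ?(YNx0 uX) ?(YNx0 vX) ?(XNx0 uX) ?(XNx0 vX)
   ?(XNY uX) ?(XNY vX) ?x0NY ?(negbTE x0X) //=.
- by rewrite uX vX eqxx in uNv.
- by case: ltngtP => // /ord_inj/enum_rank_inj uv'; rewrite uv' eqxx in uNv.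
- apply: EY_DH; rewrite mem_enum inE uv /=.
  by apply/subsetP => z; rewrite in_set2 => /orP[]/eqP->.
Qed.

Let arcXY x y : x \in X -> y \in Y -> arc_sign D x y = ([set x; y] \in E)%:Z.
Proof.
move=> xX yY; rewrite /arc_sign /D (setUC [set y]) xX yY (XNY xX) (YNX yY) (XNx0 xX) (YNx0 yY).
by rewrite /= !andbF !andbT subr0.
Qed.

Let arcYx0 y : y \in Y -> arc_sign D y x0 = ([set x0; y] \in E)%:Z.
Proof.
move=> yY; rewrite /arc_sign /D (setUC [set y]) yY x0NY (YNX yY) (negbTE x0X) (YNx0 yY) eqxx.
by rewrite /= !andbF !andbT subr0.
Qed.

Let arcx0X x : x \in X -> arc_sign D x0 x = 1.
Proof.
move=> xX; rewrite /arc_sign /D (setUC [set x0]) (hubX xX) xX x0NY (negbTE x0X) (XNx0 xX) (XNY xX) eqxx.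
by [].
Qed.

Let arcYY u y : u \in Y -> y \in Y -> arc_sign D u y = arc_sign DH u y.
Proof.
move=> uY yY; rewrite /arc_sign /D (setUC [set y]) uY yY /=.
have [//|uv] := boolP ([set u; y] \in E).
suff H a c : [set a; c] \notin E -> DH a c = false by rewrite !H // setUC.
by apply: contraNF => /DH_EY; rewrite mem_enum inE => /andP[].
Qed.

Let arcN u v : [set u; v] \notin E -> arc_sign D u v = 0.
Proof. by move=> uv; rewrite /arc_sign /D (setUC [set v]) (negbTE uv). Qed.

Let priv_inj : {in Y &, injective priv}.
Proof.
move=> y z yY zY /eqP; rewrite eq_set2; last by apply: contraTneq (zY) => ->; rewrite XNY ?pX.
by case/orP=> /andP[/eqP // e1 _]; rewrite e1 XNY ?pX in yY.
Qed.

Let hub_inj : {in X &, injective hub}.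
Proof.
move=> y z yX zX /eqP; rewrite (eq_set2 _ _ (negbT (XNx0 zX))).
by case/orP=> /andP[/eqP // e1 _]; rewrite e1 (negbTE x0X) in yX.
Qed.

Let mem_sP y : (y \in sP) = (y \in Y).
Proof. by rewrite mem_sort mem_enum. Qed.
Let mem_sR x : (x \in sR) = (x \in X).
Proof. by rewrite mem_sort mem_enum. Qed.

Let mem_mapP e : (e \in map priv sP) = (e \in P).
Proof.
by apply/mapP/imsetP => -[y]; rewrite ?mem_sP => yY ->; exists y; rewrite ?mem_sP.
Qed.
Let mem_mapR e : (e \in map hub sR) = (e \in R).
Proof.
by apply/mapP/imsetP => -[y]; rewrite ?mem_sR => yY ->; exists y; rewrite ?mem_sR.
Qed.

Let mem_s1 e : (e \in s1) = (e \in E) && (e \notin R).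
Proof.
rewrite mem_cat mem_s0 mem_mapP; have [eP|] := boolP (e \in P); last by rewrite orbF.
by rewrite (P_E eP) (P_R eP) orbT.
Qed.

Let mem_s2 e : (e \in s2) = (e \in E).
Proof.
rewrite mem_cat mem_s1 mem_mapR; have [eR|] := boolP (e \in R); last by rewrite orbF andbT.
by rewrite (R_E eR) orbT.
Qed.

Let uniq_s2 : uniq s2.
Proof.
rewrite cat_uniq [uniq s1]cat_uniq uniq_s0 /= !map_inj_in_uniq ?sort_uniq ?enum_uniq /=.
- rewrite !andbT; apply/andP; split; apply/hasPn => e.
    by rewrite mem_mapP mem_s0 => ->; rewrite andbF.
  by rewrite mem_mapR mem_s1 => ->; rewrite andbF.
- by move=> u v; rewrite !mem_sR; apply: hub_inj.
- by move=> u v; rewrite !mem_sP; apply: priv_inj.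
Qed.

Let size_s2 : size s2 = #|E|.
Proof. by rewrite -(card_uniqP uniq_s2); apply: eq_card => e; rewrite mem_s2. Qed.

Let tau_le e : e \in E -> (tau e <= #|E|)%N.
Proof. by rewrite -mem_s2 -index_mem -size_s2. Qed.

Let tau_s1 e : e \in s1 -> tau e = tau1 e.
Proof. by move=> es; rewrite /tau index_cat es. Qed.

Let tau_s0 e : e \in s0 -> tau e = tau0 e.
Proof.
move=> es; have := es; rewrite mem_s0 => /and3P[eE eP eR].
by rewrite tau_s1 ?mem_s1 ?eE // /tau1 /s1 index_cat es.
Qed.

Let tau_priv y : y \in Y -> tau (priv y) = (size s0 + index y sP).+1.
Proof.
move=> yY; have yP : priv y \in P by apply: imset_f.
rewrite tau_s1 ?mem_s1 ?(P_E yP) ?(P_R yP) // /tau1 index_cat mem_s0 yP andbF /=.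
rewrite index_map_in ?mem_sP // => u v; rewrite !mem_sP; exact: priv_inj.
Qed.

Let tau_hub x : x \in X -> tau (hub x) = (size s1 + index x sR).+1.
Proof.
move=> xX; have xR : hub x \in R by apply: imset_f.
rewrite /tau /s2 index_cat mem_s1 xR andbF.
by rewrite index_map_in ?mem_sR // => u v; rewrite !mem_sR; exact: hub_inj.
Qed.

Let h_le_tau e : e \in E -> e \notin EY -> (h <= tau e)%N.
Proof.
move=> eE eY; rewrite /tau /s2 /s1 /s0 -!catA index_cat mem_enum (negbTE eY) -cardE.
exact: leq_trans (leq_addr _ _) (leqnSn _).
Qed.

(** * Vertex sums of the construction *)

Let vs := vertex_sum D tau.

(** The reserved arc enters [y], and its label is a constant plus the rank of [y] with respect to
    [w0], which is the form treated by [index_sort_inj]. *)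
Let vsY y : y \in Y -> vs y = w0 y + (size s0 + index y sP).+1%:Z.
Proof.
move=> yY; rewrite /vs vertex_sumE (bigD1 (p y)) //= addrC; congr (_ + _); last first.
  by rewrite arcXY ?pX // setUC pE // mul1r -[in LHS]/(priv y) tau_priv.
apply: eq_bigr => u upy; have [uy|/arcN->] := boolP ([set u; y] \in E); last by rewrite !mul0r.
by rewrite tau_s0 // mem_s0 uy privN ?hubNY.
Qed.

Let vsX x : x \in X -> vs x = w1 x + (size s1 + index x sR).+1%:Z.
Proof.
move=> xX; rewrite /vs vertex_sumE (bigD1 x0) //= addrC; congr (_ + _); last first.
  by rewrite arcx0X // mul1r setUC -[in LHS]/(hub x) tau_hub.
apply: eq_bigr => u ux; have [uy|/arcN->] := boolP ([set u; x] \in E); last by rewrite !mul0r.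
by rewrite tau_s1 // mem_s1 uy hubNX.
Qed.

Let vsY_inj : {in Y &, injective vs}.
Proof.
move=> y z yY zY; rewrite !vsY // => H.
apply: (@index_sort_inj _ w0 (enum Y)); rewrite ?mem_enum //.
by move: H; rewrite -/sP; lia.
Qed.

Let vsX_inj : {in X &, injective vs}.
Proof.
move=> y z yX zX; rewrite !vsX // => H.
apply: (@index_sort_inj _ w1 (enum X)); rewrite ?mem_enum //.
by move: H; rewrite -/sR; lia.
Qed.

Let split_sum (F : T -> int) : \sum_u F u = F x0 + \sum_(u in X) F u + \sum_(u in Y) F u.
Proof.
rewrite (bigID (mem (x0 |: X))) /= big_setU1 //=; congr (_ + _).
by apply: eq_bigl => u; rewrite in_setC.
Qed.

Let term_norm u v : `|arc_sign D u v * (tau [set u; v])%:Z| <= #|E|%:Z.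
Proof.
have [uv|/arcN->] := boolP ([set u; v] \in E); last by rewrite mul0r normr0.
rewrite normrM -[leRHS]mul1r; apply: ler_pM => //; first exact: arc_sign_norm.
by rewrite /= lez_nat tau_le.
Qed.

Let sumX_norm v : `|\sum_(u in X) arc_sign D u v * (tau [set u; v])%:Z| <= #|X|%:Z * #|E|%:Z.
Proof.
apply: le_trans (ler_norm_sum _ _ _) _.
apply: le_trans (ler_sum _ (fun u _ => term_norm u v)) _.
by rewrite sumr_const -mulr_natl natz.
Qed.

(** The edges counted here have the end [x] outside [Y], so each of the at least [d] of them has a
    label of at least [h]. *)
Let degsum x : x \in x0 |: X ->
  d%:Z * h%:Z <= \sum_(u in Y) ([set x; u] \in E)%:Z * (tau [set x; u])%:Z.
Proof.
move=> xX; pose N := [set y in Y | [set x; y] \in E].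
apply: (@le_trans _ _ (\sum_(u in N) h%:Z)).
  by rewrite sumr_const -mulr_natl natz ler_wpM2r // lez_nat degY.
rewrite big_mkcond [leRHS]big_mkcond; apply: ler_sum => u _; rewrite in_set.
have [uY|//] := boolP (u \in Y); have [xu|] := boolP ([set x; u] \in E) => //=.
rewrite mul1r lez_nat h_le_tau // inE xu /=; apply/negP => /subsetP/(_ x).
by rewrite set21 in_setC xX => /(_ isT).
Qed.

(** One square is at most the sum of all squares, which [DH_sum] and [b_large] bound by the square
    of [b]. *)
Let sumY_norm y : y \in Y -> `|\sum_(u in Y) arc_sign D u y * (tau [set u; y])%:Z| <= b%:Z.
Proof.
move=> yY.
have -> : \sum_(u in Y) arc_sign D u y * (tau [set u; y])%:Z = vertex_sum DH tau0 y.
  rewrite vertex_sumE [RHS](bigID (mem Y)) /= [X in _ + X]big1 ?addr0 => [|u uY].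
    apply: eq_bigr => u uY; have [uy|uy] := boolP ([set u; y] \in E).
      rewrite arcYY // tau_s0 // mem_cat mem_enum inE uy /=.
      by apply/orP; left; apply/subsetP => z; rewrite in_set2 => /orP[]/eqP->.
    by rewrite -arcYY // arcN // !mul0r.
  suff H a c : (a \notin Y) || (c \notin Y) -> DH a c = false.
    by rewrite /arc_sign !H ?mul0r // uY ?orbT.
  move=> H; apply: contraTF H => /DH_EY; rewrite mem_enum inE => /andP[_ /subsetP ac].
  by rewrite negb_or !negbK !ac ?set21 ?set22.
have H : vertex_sum DH tau0 y ^+ 2 <= b%:Z ^+ 2.
  apply: (@le_trans _ _ (\sum_v vertex_sum DH tau0 v ^+ 2)).
    by rewrite (bigD1 y) //= lerDl sumr_ge0 // => v _; rewrite sqr_ge0.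
  apply: le_trans DH_sum _; rewrite sum_tau0.
  by move: b_large; rewrite -lez_nat PoszM; lia.
by rewrite -(ler_pXn2r (n := 2)) ?nnegrE // -normrX ger0_norm ?sqr_ge0.
Qed.

Let vsX_low x : x \in X -> vs x <= #|X|%:Z * #|E|%:Z + #|E|%:Z - d%:Z * h%:Z.
Proof.
move=> xX; rewrite /vs vertex_sumE split_sum.
have := sumX_norm x; have := term_norm x0 x; rewrite !ler_norml => /andP[_ H1] /andP[_ H2].
have -> : \sum_(u in Y) arc_sign D u x * (tau [set u; x])%:Z =
   - \sum_(u in Y) ([set x; u] \in E)%:Z * (tau [set x; u])%:Z.
  rewrite -sumrN; apply: eq_bigr => u uY; rewrite arc_signC arcXY // mulNr.
  by rewrite (setUC [set u]).
have := degsum (setU1r x0 xX); lra.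
Qed.

Let vs_x0 : d%:Z * h%:Z - #|X|%:Z * #|E|%:Z <= vs x0.
Proof.
rewrite /vs vertex_sumE split_sum.
have := sumX_norm x0; rewrite !ler_norml => /andP[H2 _].
have -> : arc_sign D x0 x0 = 0 by rewrite /arc_sign subrr.
have -> : \sum_(u in Y) arc_sign D u x0 * (tau [set u; x0])%:Z =
   \sum_(u in Y) ([set x0; u] \in E)%:Z * (tau [set x0; u])%:Z.
  by apply: eq_bigr => u uY; rewrite arcYx0 // (setUC [set u]).
have := degsum (setU11 x0 X); lra.
Qed.

(** Arcs from [X] enter [y] and a possible arc to [x0] leaves it, so the former only affect the
    upper bound and the latter only the lower one. *)
Let vsY_bound y : y \in Y -> - b%:Z - #|E|%:Z <= vs y <= b%:Z + #|X|%:Z * #|E|%:Z.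
Proof.
move=> yY; rewrite /vs vertex_sumE split_sum.
have := sumX_norm y; have := sumY_norm yY; have := term_norm x0 y.
rewrite !ler_norml => /andP[H1 _] /andP[H2 H3] /andP[_ H4].
have H5 : 0 <= \sum_(u in X) arc_sign D u y * (tau [set u; y])%:Z.
  by apply: sumr_ge0 => u uX; rewrite arcXY.
have H6 : arc_sign D x0 y * (tau [set x0; y])%:Z <= 0.
  by rewrite arc_signC arcYx0 // mulNr oppr_le0.
by apply/andP; split; lra.
Qed.

Let vs_inj : injective vs.
Proof.
have gapZ : b%:Z + (2 * #|X|%:Z + 2) * #|E|%:Z < d%:Z * h%:Z by move: gap; lia.
have gap' : b%:Z + 2 * (#|X|%:Z * #|E|%:Z) + 2 * #|E|%:Z < d%:Z * h%:Z by lia.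
have XE : 0 <= #|X|%:Z * #|E|%:Z by [].
move=> u v uv.
have [uX|uX|uX] := VP u; have [vX|vX|vX] := VP v.
- by rewrite uX.
- by have := vsX_low vX; have := vs_x0; rewrite -uv uX; lia.
- by have := vsY_bound vX; have := vs_x0; rewrite -uv uX; lia.
- by have := vsX_low uX; have := vs_x0; rewrite uv vX; lia.
- exact: vsX_inj.
- by have := vsX_low uX; have := vsY_bound vX; rewrite uv; lia.
- by have := vsY_bound uX; have := vs_x0; rewrite uv vX; lia.
- by have := vsX_low vX; have := vsY_bound uX; rewrite uv; lia.
- exact: vsY_inj.
Qed.

Lemma hub_antimagic_of_balanced : antimagic_orientation G.
Proof. by exists D, tau; split=> //; apply: index_edge_labeling. Qed.
End HubConstruction.

Lemma hub_antimagic (T : finType) (G : sgraph T) (x0 : T) (X : {set T}) (d b : nat)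
    (Y := ~: (x0 |: X)) (h := #|[set e in edges G | e \subset Y]|) :
    x0 \notin X ->
    (forall x, x \in X -> [set x; x0] \in edges G) ->
    (forall y, y \in Y -> exists2 x, x \in X & [set y; x] \in edges G) ->
    (forall x, x \in x0 |: X -> (d <= #|[set y in Y | [set x; y] \in edges G]|)%N) ->
    (2 * \sum_(i < h) i.+1 ^ 2 <= b ^ 2)%N ->
    (b + (2 * #|X| + 2) * #|edges G| < d * h)%N ->
  antimagic_orientation G.
Proof.
move=> x0X hubX domY degY b_large gap.
(* The default [y] is never taken on [Y], where [domY] provides a neighbour in [X]. *)
pose p y := odflt y [pick x in X | [set y; x] \in edges G].
have pP y : y \in Y -> (p y \in X) && ([set y; p y] \in edges G).
  move=> /domY[x xX yx]; rewrite /p; case: pickP => //= /(_ x).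
  by rewrite xX yx.
have pX y : y \in Y -> p y \in X by move=> /pP/andP[].
have pE y : y \in Y -> [set y; p y] \in edges G by move=> /pP/andP[].
pose EY := [set e in edges G | e \subset Y].
(* This is the list [s0] of the construction, so that the greedy orientation is balanced for the
   labels finally used inside [Y]. *)
pose s0 := enum EY ++ enum (edges G :\: EY :\: [set [set y; p y] | y in Y]
                                           :\: [set [set x; x0] | x in X]).
have [||DH [DH1 DH2 DH3]] := @balanced_orientation T (fun e => (index e s0).+1) (enum EY).
- exact: enum_uniq.
- move=> e; rewrite mem_enum inE => /andP[eE _].
  by have /subsetP/(_ _ eE) := valP G; rewrite inE => /eqP.
exact: hub_antimagic_of_balanced x0X hubX pX pE degY b_large gap _ DH1 DH2 DH3.
Qed.

(** * Numerical parameters of the hub *)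

Lemma sum_squares (h : nat) : (6 * \sum_(i < h) i.+1 ^ 2 = h * h.+1 * (2 * h + 1))%N.
Proof. by elim: h => [|h IH]; rewrite ?big_ord0 // big_ord_recr /= mulnDr IH; nia. Qed.

Lemma card_edges_within (T : finType) (G : sgraph T) (B : {set T}) :
  (#|edges G| <= #|[set e in edges G | e \subset ~: B]| + #|B| * #|T|)%N.
Proof.
rewrite -(cardsID [set e : {set T} | e \subset ~: B] (edges G)) leq_add //.
  by rewrite subset_leq_card //; apply/subsetP => e; rewrite !inE.
rewrite -cardsT -cardsX; apply: leq_trans (leq_imset_card (fun q => [set q.1; q.2]) _).
apply: subset_leq_card; apply/subsetP => e; rewrite !inE => /andP[/subsetPn[x xe xB] eG].
have /subsetP/(_ _ eG) := valP G; rewrite inE => /cards2P[u [v [uv Ee]]].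
rewrite inE negbK in xB; move: xe; rewrite Ee in_set2 => /orP[]/eqP xE.
  by apply/imsetP; exists (x, v); rewrite ?inE ?xB //= xE.
by apply/imsetP; exists (x, u); rewrite ?inE ?xB //= xE setUC.
Qed.

Lemma dense_hub_antimagic (T : finType) (G : sgraph T) (x0 : T) (X : {set T}) (d k : nat)
    (n := #|T|) (Y := ~: (x0 |: X)) :
    x0 \notin X -> (#|X| <= k)%N -> (200 * k.+1 <= n)%N ->
    (forall x, x \in X -> [set x; x0] \in edges G) ->
    (forall y, y \in Y -> exists2 x, x \in X & [set y; x] \in edges G) ->
    (forall x, x \in x0 |: X -> (d <= #|[set y in Y | [set x; y] \in edges G]|)%N) ->
    (19 * n <= 40 * d + 20 * k.+1)%N ->
    (n ^ 2 <= 5 * #|edges G|)%N -> (40 * #|edges G| <= 11 * n ^ 2)%N ->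
  antimagic_orientation G.
Proof.
move=> x0X Xk kn hubX domY degY dn m_ge m_le.
pose h := #|[set e in edges G | e \subset Y]|.
have hm : (#|edges G| <= h + k.+1 * n)%N.
  apply: leq_trans (card_edges_within G (x0 |: X)) _.
  by rewrite leq_add2l cardsU1 x0X leq_mul2r [(_ <= k.+1)%N]Xk orbT.
have hle : (h <= #|edges G|)%N.
  by apply: subset_leq_card; apply/subsetP => e; rewrite inE => /andP[].
(* At most [k.+1 * n] edges leave [Y], which is at most half of all edges as
   [n ^ 2 <= 5 * #|edges G|]. *)
have m2h : (#|edges G| <= 2 * h)%N.
  have : (10 * (k.+1 * n) <= n ^ 2)%N by rewrite mulnA -mulnn leq_mul2r; lia.
  lia.
have h_gt0 : (0 < h)%N by nia.
(* [c] must lie between [sqrt (2 h / 3)], at most [0.429 n], and [d], at least [0.475 n] up to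
   a multiple of [k]. *)
pose c := (43 * n %/ 100).+1.
have c1 : (43 * n <= 100 * c)%N by rewrite /c; lia.
have c2 : (100 * c <= 43 * n + 100)%N by rewrite /c; lia.
apply: (@hub_antimagic T G x0 X d (c * h)) => //; rewrite -/Y -/h.
  (* The requirement amounts to [h.+1 * (2 * h + 1) <= 3 * c ^ 2 * h]; the summand 8 pays for the
     lower-order terms in [h]. *)
  have c3 : (4 * h + 8 <= 6 * c ^ 2)%N by nia.
  have := sum_squares h; nia.
have cd : (c + 4 * k.+1 < d)%N by lia.
(* Since [#|edges G| <= 2 * h], the error term is at most [4 * k.+1 * h], and [h] cancels. *)
apply: (@leq_ltn_trans ((c + 4 * k.+1) * h)); last by rewrite ltn_pmul2r.
rewrite [leqRHS]mulnDl leq_add2l; apply: (@leq_trans ((2 * k.+1) * (2 * h))); last by lia.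
by apply: leq_mul => //; lia.
Qed.

(** * Counting edge sets by toggling *)

Section Toggle.
Variables (I : finType) (A : {set I}).

Definition toggle (e : I) (E : {set I}) := if e \in E then E :\ e else e |: E.

Lemma in_toggle e f E : (f \in toggle e E) = (f == e) (+) (f \in E).
Proof.
rewrite /toggle; have [eE|eE] := boolP (e \in E); rewrite !inE;
  by have [->|//] := eqVneq f e; rewrite ?eE ?(negbTE eE).
Qed.

Lemma toggleK e : involutive (toggle e).
Proof. by move=> E; apply/setP => f; rewrite !in_toggle addbA addbb. Qed.

Lemma toggle_sub e E : e \in A -> (toggle e E \subset A) = (E \subset A).
Proof.
move=> eA; have H (F : {set I}) : F \subset A -> toggle e F \subset A.
  move=> /subsetP FA; apply/subsetP => f; rewrite in_toggle.
  by have [->|_ /FA] := eqVneq f e.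
by apply/idP/idP => [/H|/H//]; rewrite toggleK.
Qed.

(** Toggling [e] exchanges the sets with and without [e] and preserves [Q]. This replaces the
    independence of [e] from an event that ignores it. *)
Lemma card_toggle_half e (Q : pred {set I}) : e \in A ->
    (forall E, Q (toggle e E) = Q E) ->
  (2 * #|[set E in powerset A | Q E && (e \in E)]| = #|[set E in powerset A | Q E]|)%N.
Proof.
move=> eA Qe; rewrite -(cardsID [set E : {set I} | e \in E] [set E in powerset A | Q E]).
rewrite mul2n -addnn; congr (_ + _)%N; first by apply: eq_card => E; rewrite !inE andbA.
rewrite -(card_imset _ (inv_inj (toggleK e))); apply: eq_card => E.
rewrite -{1}(toggleK e E) (mem_imset _ _ (inv_inj (toggleK e))) !inE toggle_sub // Qe.
by rewrite in_toggle eqxx andbA andbC.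
Qed.

Lemma card_toggle_pair e f (Q : pred {set I}) : e \in A -> f \in A -> e != f ->
    (forall E, Q (toggle e E) = Q E) -> (forall E, Q (toggle f E) = Q E) ->
  (4 * #|[set E in powerset A | Q E && ~~ ((e \in E) && (f \in E))]| =
   3 * #|[set E in powerset A | Q E]|)%N.
Proof.
move=> eA fA ef Qe Qf; have H1 := card_toggle_half eA Qe.
have H2 : (2 * #|[set E in powerset A | Q E && (e \in E) && (f \in E)]| =
            #|[set E in powerset A | Q E && (e \in E)]|)%N.
  by apply: (card_toggle_half fA) => E; rewrite Qf in_toggle (negbTE ef).
suff : (#|[set E in powerset A | Q E]| =
    #|[set E in powerset A | Q E && (e \in E) && (f \in E)]| +
    #|[set E in powerset A | Q E && ~~ ((e \in E) && (f \in E))]|)%N.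
  by move: H1 H2; do !move: #|_|; lia.
rewrite -(cardsID [set E : {set I} | (e \in E) && (f \in E)] [set E in powerset A | Q E]).
by congr (_ + _)%N; apply: eq_card => E; rewrite !inE -?andbA // andbC -andbA.
Qed.

(** The pairs [e z], [f z] are disjoint for distinct [z], so each [z] contributes an independent
    factor 3/4. *)
Lemma card_no_pair (J : eqType) (e f : J -> I) (zs : seq J) :
    uniq zs -> {in zs, forall z, (e z \in A) && (f z \in A)} ->
    {in zs &, injective e} -> {in zs &, injective f} ->
    {in zs &, forall z z', e z != f z'} ->
  (4 ^ size zs * #|[set E in powerset A | all (fun z => ~~ ((e z \in E) && (f z \in E))) zs]|
   = 3 ^ size zs * 2 ^ #|A|)%N.
Proof.
elim: zs => [|z zs IH] /=.
  rewrite !expn0 !mul1n -card_powerset => _ _ _ _ _.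
  by apply: eq_card => E; rewrite !inE andbT.
move=> /andP[zzs uzs] mA ie jf ef.
have sub y : y \in zs -> y \in z :: zs by rewrite inE orbC => ->.
have zz := mem_head z zs.
have /andP[ezA fzA] := mA _ zz.
pose Q (E : {set I}) := all (fun z => ~~ ((e z \in E) && (f z \in E))) zs.
have neq y : y \in zs -> y == z = false by move=> yz; apply: contraNF zzs => /eqP <-.
have Qe E : Q (toggle (e z) E) = Q E.
  apply: eq_in_all => y yzs; rewrite !in_toggle (inj_in_eq ie (sub _ yzs) zz) neq //.
  by rewrite eq_sym (negbTE (ef _ _ zz (sub _ yzs))).
have Qf E : Q (toggle (f z) E) = Q E.
  apply: eq_in_all => y yzs; rewrite !in_toggle (inj_in_eq jf (sub _ yzs) zz) neq //.
  by rewrite (negbTE (ef _ _ (sub _ yzs) zz)).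
have := card_toggle_pair ezA fzA (ef _ _ zz zz) Qe Qf.
have -> : #|[set E in powerset A | Q E && ~~ ((e z \in E) && (f z \in E))]| =
  #|[set E in powerset A | ~~ ((e z \in E) && (f z \in E)) && Q E]|.
  by apply: eq_card => E; rewrite !inE [Q E && _]andbC.
rewrite !expnS => H4; rewrite -mulnA mulnCA H4 mulnCA IH ?mulnA //.
- by move=> y /sub; apply: mA.
- by move=> y y' /sub yz /sub; apply: ie.
- by move=> y y' /sub yz /sub; apply: jf.
- by move=> y y' /sub yz /sub; apply: ef.
Qed.

(** * Second moments and Chebyshev's inequality *)

Definition mem_sign (E : {set I}) (e : I) : int := if e \in E then 1 else -1.

Lemma sum_mem_sign (E S : {set I}) : \sum_(e in S) mem_sign E e = 2 * #|E :&: S|%:Z - #|S|%:Z.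
Proof.
have -> : #|E :&: S|%:Z = \sum_(e in S) (e \in E)%:Z.
  rewrite -sum1_card -natz natr_sum (eq_bigl (fun e => (e \in S) && (e \in E))).
    by rewrite big_mkcondr; apply: eq_bigr => e _; case: (e \in E).
  by move=> e; rewrite inE andbC.
rewrite -(natz #|S|) -sumr_const mulr_sumr -sumrB; apply: eq_bigr => e _.
by rewrite /mem_sign; case: (e \in E).
Qed.

(** Expanding the square, each diagonal term is 1, and the terms for [e] and [f] distinct cancel,
    because toggling [e] changes the sign of one factor only. *)
Lemma sum_mem_sign_sqr (S : {set I}) : S \subset A ->
  \sum_(E in powerset A) (2 * #|E :&: S|%:Z - #|S|%:Z) ^+ 2 = (#|S| * 2 ^ #|A|)%N%:Z.
Proof.
move=> /subsetP SA; under eq_bigr => E _ do rewrite -sum_mem_sign expr2 mulr_suml.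
rewrite exchange_big /=.
have H e : e \in S -> \sum_(E in powerset A) mem_sign E e * \sum_(f in S) mem_sign E f = (2 ^ #|A|)%N%:Z.
  move=> eS; under eq_bigr do rewrite mulr_sumr.
  rewrite exchange_big (bigD1 e) //= [X in _ + X]big1 ?addr0.
    rewrite (eq_bigr (fun=> 1)) => [|E _]; last by rewrite /mem_sign; case: ifP.
    by rewrite sumr_const card_powerset natz.
  move=> f /andP[fS fe]; set s := (X in X = _).
  suff : s = - s by lia.
  rewrite {1}/s (reindex_inj (inv_inj (toggleK e))) -sumrN /=.
  apply: eq_big => [E|E _]; first by rewrite !inE toggle_sub ?SA.
  rewrite /mem_sign !in_toggle eqxx (negbTE fe) /=.
  by case: (e \in E) => /=; rewrite ?mulNr ?opprK.
by rewrite (eq_bigr _ H) sumr_const -mulr_natl natz PoszM.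
Qed.

(** The deviation from the mean [#|S| / 2] is doubled to stay within the integers. *)
Definition deviant (t : nat) (S E : {set I}) : bool :=
  t%:Z <= `|2 * #|E :&: S|%:Z - #|S|%:Z|.

Lemma card_deviant (S : {set I}) (t : nat) : S \subset A ->
  (t ^ 2 * #|[set E in powerset A | deviant t S E]| <= #|S| * 2 ^ #|A|)%N.
Proof.
move=> SA; rewrite -lez_nat -sum_mem_sign_sqr // (bigID (deviant t S)) /=.
rewrite -[leLHS]addr0 lerD //; last by apply: sumr_ge0 => E _; rewrite sqr_ge0.
rewrite (eq_bigl (fun E => E \in [set E in powerset A | deviant t S E])); last first.
  by move=> E; rewrite inE.
rewrite PoszM mulrC -[X in X * _]natz mulr_natl -sumr_const.
apply: ler_sum => E; rewrite inE => /andP[_ tE].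
by rewrite -[leRHS]ger0_norm ?sqr_ge0 // normrX; move: tE; rewrite /deviant; nia.
Qed.

End Toggle.

(** * A random hub *)

Lemma card_vpairs (T : finType) : (2 * #|vpairs T| = #|T| * #|T|.-1)%N.
Proof. by rewrite /vpairs card_draws mulnC (bin_ffact _ 2) ffactnS ffactn1. Qed.

(** Chebyshev's inequality gives the proportion [800 / n ^ 2], weakened here to [800 / n]. Replacing
    20 by 40 absorbs the rounding in [t1]. *)
Lemma card_deviant_vpairs (T : finType) (n := #|T|) (t1 := (n ^ 2 %/ 20)%N) : (40 <= n)%N ->
  (n * #|[set E in powerset (vpairs T) | deviant t1 (vpairs T) E]|
     <= 800 * 2 ^ #|vpairs T|)%N.
Proof.
move=> n40; have := card_deviant t1 (subxx (vpairs T)); have := card_vpairs T; rewrite -/n.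
move: #|vpairs T| #|[set _ in _ | _]| (expn 2 _) => s B N sn.
have t40 : (n ^ 2 <= 40 * t1)%N by rewrite /t1; nia.
have s2 : (2 * s <= n ^ 2)%N by rewrite sn -mulnn leq_mul2l leq_pred orbT.
move=> H; apply: (@leq_trans (n ^ 2 * B)); first by nia.
rewrite -(@leq_pmul2l (n ^ 2)) ?expn_gt0 ?(leq_trans _ n40) //.
apply: (@leq_trans (1600 * (t1 ^ 2 * B))).
  have : (n ^ 2 * n ^ 2 * B <= (40 * t1) * (40 * t1) * B)%N by rewrite leq_mul2r leq_mul ?orbT.
  lia.
have : (2 * s * N <= n ^ 2 * N)%N by rewrite leq_mul2r s2 orbT.
lia.
Qed.

Section RandomHub.
Variables (T : finType) (x0 : T) (Z : {set T}).
Hypothesis x0Z : x0 \notin Z.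
Let n := #|T|.
Let k := #|Z|.

(** The set [Y] depends on the graph, but it always contains the complement of [x0 |: Z], so these
    fixed stars bound the degrees into [Y] from below. *)
Definition star_outside (x : T) : {set {set T}} := [set [set x; y] | y in ~: (x0 |: Z)].

(** Vertices of [Z] not adjacent to [x0] belong to [Y] and need a neighbour in [X] too, so [y] may
    lie in [Z] and is then removed from the candidates. *)
Definition undominated (E : {set {set T}}) (y : T) : bool :=
  all (fun z => ~~ (([set z; x0] \in E) && ([set z; y] \in E))) (enum (Z :\ y)).

Lemma star_injective (x : T) : x \in x0 |: Z ->
  {in ~: (x0 |: Z) &, injective (fun y => [set x; y])}.
Proof.
move=> xZ y y' yZ y'Z /eqP; have xy a : a \in ~: (x0 |: Z) -> x != a.
  by apply: contraTneq => <-; rewrite in_setC negbK.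
rewrite eq_set2 ?xy // => /orP[] /andP[/eqP e1 /eqP e2] //.
by move: (xy _ y'Z); rewrite e1 eqxx.
Qed.

Lemma star_sub (x : T) : x \in x0 |: Z -> star_outside x \subset vpairs T.
Proof.
move=> xZ; apply/subsetP => _ /imsetP[y yZ ->]; rewrite inE cards2.
by case: (x =P y) yZ => [<-|//]; rewrite in_setC xZ.
Qed.

Lemma card_star (x : T) : x \in x0 |: Z -> (#|star_outside x| + k.+1 = n)%N.
Proof.
move=> xZ; rewrite card_in_imset; last exact: star_injective.
have := cardsC (x0 |: Z); rewrite cardsU1 x0Z /= -/k -/n; lia.
Qed.

Lemma random_hub_antimagic (G : sgraph T) (t1 := (n ^ 2 %/ 20)%N) (t := (n %/ 20)%N) :
    (200 * k.+1 <= n)%N ->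
    ~~ deviant t1 (vpairs T) (edges G) ->
    (forall x, x \in x0 |: Z -> ~~ deviant t (star_outside x) (edges G)) ->
    (forall y, y != x0 -> ~~ undominated (edges G) y) ->
  antimagic_orientation G.
Proof.
move=> kn dev1 dev2 dom.
pose X := [set z in Z | [set z; x0] \in edges G].
have XZ : X \subset Z by apply/subsetP => z; rewrite inE => /andP[].
have x0X : x0 \notin X by rewrite inE (negbTE x0Z).
have VZ : ~: (x0 |: Z) \subset ~: (x0 |: X) by rewrite setCS setUS.
have EA : edges G :&: vpairs T = edges G by apply/setIidPl; exact: (valP G).
move: dev1; rewrite /deviant EA -ltNge => dev1; have cA := card_vpairs T; rewrite -/n in cA.
(* A star has [n - k - 1] edges, and the strict bound on the doubled deviation gives at least
   [(n - k - t) / 2] of them in the graph. *)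
apply: (@dense_hub_antimagic T G x0 X ((n - k - t) %/ 2) k) => //; rewrite -/n.
- exact: subset_leq_card.
- by move=> x; rewrite inE => /andP[].
- move=> y; rewrite in_setC in_setU1 negb_or => /andP[/dom /allPn[z]].
  rewrite mem_enum in_setD1 negbK => /andP[_ zZ] /andP[zx0 zy] _.
  by exists z; [rewrite inE zZ | rewrite setUC].
- move=> x xX; have xZ : x \in x0 |: Z by apply: (subsetP (setUS _ XZ)).
  have := dev2 _ xZ; have := card_star xZ; rewrite /deviant -ltNge => c1 c2.
  apply: (@leq_trans #|edges G :&: star_outside x|); first lia.
  apply: leq_trans (leq_imset_card (fun y => [set x; y]) _).
  apply: subset_leq_card; apply/subsetP => e; rewrite in_setI => /andP[eE /imsetP[y yZ ey]].
  by apply/imsetP; exists y; rewrite // in_set (subsetP VZ) // -ey.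
- lia.
- have : (0 < n)%N by lia. rewrite /t1 in dev1. nia.
- rewrite /t1 in dev1. nia.
Qed.

Lemma card_deviant_star (x : T) (t := (n %/ 20)%N) : (40 <= n)%N -> x \in x0 |: Z ->
  (n * #|[set E in powerset (vpairs T) | deviant t (star_outside x) E]|
     <= 1600 * 2 ^ #|vpairs T|)%N.
Proof.
move=> n40 xZ; have := card_deviant t (star_sub xZ); have := card_star xZ.
move: #|[set _ in _ | _]| (expn 2 _) #|star_outside x| => B N s sn.
have t40 : (n <= 40 * t)%N by rewrite /t; lia.
move=> H; rewrite -(@leq_pmul2l n) ?(leq_trans _ n40) //.
apply: (@leq_trans (1600 * (t ^ 2 * B))).
  have : (n * n * B <= (40 * t) * (40 * t) * B)%N by rewrite leq_mul2r leq_mul ?orbT.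
  lia.
by have : (s * N <= n * N)%N by [rewrite leq_mul2r; apply/orP; right; lia]; nia.
Qed.

(** Each candidate [z] fails with probability 3/4, independently. The extra element in [k] leaves
    [9 * L] candidates even if [y] lies in [Z]. *)
Lemma card_undominated (y : T) (L : nat) : k = (9 * L).+1 -> y != x0 ->
  (8 ^ L * #|[set E in powerset (vpairs T) | undominated E y]| <= 2 ^ #|vpairs T|)%N.
Proof.
move=> kL yx0.
have zP z : z \in enum (Z :\ y) -> [/\ z \in Z, z != x0 & z != y].
  rewrite mem_enum in_setD1 => /andP[zy zZ]; split=> //.
  by apply: contraNneq x0Z => <-.
have := @card_no_pair _ (vpairs T) _ (fun z => [set z; x0]) (fun z => [set z; y]) (enum (Z :\ y)).
rewrite -/(undominated _ y) => /(_ (enum_uniq _)) H.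
have {}H := H _ _ _ _.
have {H} : (4 ^ size (enum (Z :\ y)) * #|[set E in powerset (vpairs T) | undominated E y]| =
    3 ^ size (enum (Z :\ y)) * 2 ^ #|vpairs T|)%N.
  apply: H.
  - by move=> z /zP[_ z1 z2]; rewrite !inE !cards2 z1 z2.
  - move=> z z' /zP[_ z1 z2] /zP[_ z1' z2'] /eqP; rewrite eq_set2 //.
    by case/orP=> /andP[/eqP // e1]; rewrite e1 eqxx in z1.
  - move=> z z' /zP[_ z1 z2] /zP[_ z1' z2'] /eqP; rewrite eq_set2 //.
    by case/orP=> /andP[/eqP // e1]; rewrite e1 eqxx in z2.
  - move=> z z' /zP[_ z1 z2] /zP[_ z1' z2']; rewrite eq_set2 // negb_or !negb_and.
    by rewrite [x0 == y]eq_sym yx0 z2 orbT.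
have : (9 * L <= size (enum (Z :\ y)))%N.
  by rewrite -cardE; have := cardsD1 y Z; rewrite -/k kL; case: (y \in Z); lia.
move: #|[set _ in _ | _]| (expn 2 _) (size _) => B N s sL H.
have H8 : (8 ^ L * 3 ^ s <= 4 ^ s)%N.
  (* [2 * 3 ^ 3 <= 4 ^ 3] *)
  have -> : s = (3 * (3 * L) + (s - 9 * L))%N by lia.
  rewrite (expnD 3 (3 * (3 * L))) (expnD 4 (3 * (3 * L))) mulnA; apply: leq_mul; last first.
    by case: (s - 9 * L)%N => // j; rewrite leq_exp2r.
  have -> : (8 ^ L = 2 ^ (3 * L))%N by rewrite expnM.
  rewrite (expnM 3 3) (expnM 4 3) -expnMn; case: (3 * L)%N => // j.
  by rewrite leq_exp2r.
rewrite -(@leq_pmul2l (4 ^ s)) ?expn_gt0 //.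
by rewrite mulnCA H mulnA leq_mul2r H8 orbT.
Qed.
End RandomHub.

Lemma leq_card_bigcup (I J : finType) (P : pred J) (F : J -> {set I}) :
  (#|\bigcup_(j | P j) F j| <= \sum_(j | P j) #|F j|)%N.
Proof.
elim/big_ind2: _ => [|a A b B Aa Bb|//]; first by rewrite cards0.
by apply: (leq_trans (leq_card_setU A B).1); apply: leq_add.
Qed.

(** A union bound, dominated by the [(9 * L).+2] stars, each deviant with probability at most
    [1600 / n]. *)
Lemma card_not_antimagic (T : finType) (n := #|T|) (L := trunc_log 2 n) :
    (200 * (9 * L).+2 <= n)%N ->
  exists bad : {set {set {set T}}},
    (n * #|bad| <= 4000 * (4 * L.+1) * 2 ^ #|vpairs T|)%N /\
    forall G : sgraph T, edges G \notin bad -> antimagic_orientation G.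
Proof.
move=> nL; have n40 : (40 <= n)%N by lia.
have /card_gt0P[x0 _] : (0 < #|T|)%N by rewrite -/n; lia.
pose k := (9 * L).+1.
pose Z := [set z in take k (enum [set~ x0])].
have x0Z : x0 \notin Z.
  by rewrite inE; apply/negP => /mem_take; rewrite mem_enum !inE eqxx.
have cZ : #|Z| = k.
  rewrite cardsE (card_uniqP _) ?take_uniq ?enum_uniq // size_takel // -cardE cardsC1 -/n; lia.
pose A := powerset (vpairs T).
pose B1 := [set E in A | deviant (n ^ 2 %/ 20) (vpairs T) E].
pose B2 x := [set E in A | deviant (n %/ 20) (star_outside x0 Z x) E].
pose B3 y := [set E in A | undominated x0 Z E y].
exists (B1 :|: \bigcup_(x in x0 |: Z) B2 x :|: \bigcup_(y | y != x0) B3 y); split; last first.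
  move=> G; rewrite !in_setU !negb_or -andbA => /and3P[b1 b2 b3].
  have EA : edges G \in A by rewrite inE; apply: (valP G).
  apply: (random_hub_antimagic x0Z); rewrite ?cZ //.
  - by move: b1; rewrite inE EA.
  - by move=> x xZ; apply: contraNN b2 => dx; apply/bigcupP; exists x; rewrite // inE EA.
  - by move=> y yx; apply: contraNN b3 => dx; apply/bigcupP; exists y; rewrite // inE EA.
set N := (2 ^ #|vpairs T|)%N.
have h1 : (n * #|B1| <= 800 * N)%N by exact: card_deviant_vpairs.
have h2 : (n * #|\bigcup_(x in x0 |: Z) B2 x| <= 1600 * k.+1 * N)%N.
  apply: leq_trans (leq_mul (leqnn n) (leq_card_bigcup _ _)) _.
  rewrite big_distrr /=; apply: (@leq_trans (\sum_(x in x0 |: Z) 1600 * N)%N).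
    by apply: leq_sum => x xZ; apply: card_deviant_star.
  by rewrite sum_nat_const cardsU1 x0Z cZ; lia.
have h3 : (n * #|\bigcup_(y | y != x0) B3 y| <= 4 * N)%N.
  have : (8 ^ L * #|\bigcup_(y | y != x0) B3 y| <= n * N)%N.
    apply: leq_trans (leq_mul (leqnn _) (leq_card_bigcup _ _)) _.
    rewrite big_distrr /=; apply: (@leq_trans (\sum_(y | y != x0) N)%N).
      by apply: leq_sum => y yx; apply: card_undominated.
    by rewrite sum_nat_const leq_mul2r max_card orbT.
  (* With [a] for [2 ^ L] and [b] for the cardinality, [n < 2 * a] and [a ^ 3 * b <= n * N] give
     [a ^ 2 * b <= 2 * N], hence [n * b <= 4 * N]. *)
  have := @trunc_log_ltn 2 n isT; rewrite -/L expnS.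
  have -> : 8%N = (2 * 2 * 2)%N by [].
  rewrite !expnMn; move: #|_|; have : (0 < 2 ^ L)%N by rewrite expn_gt0.
  move: (2 ^ L)%N => a a0 b na H.
  have {}H : (a * a * b <= 2 * N)%N.
    rewrite -(@leq_pmul2l a) //; apply: (@leq_trans (n * N)); first by nia.
    by apply: (@leq_trans (2 * a * N)); [rewrite leq_mul2r ltnW ?orbT | lia].
  apply: (@leq_trans (2 * a * b)); first by rewrite leq_mul2r ltnW ?orbT.
  by have : (a * b <= a * a * b)%N by [rewrite leq_mul2r leq_pmulr ?orbT]; lia.
apply: (@leq_trans (n * (#|B1| + #|\bigcup_(x in x0 |: Z) B2 x| + #|\bigcup_(y | y != x0) B3 y|))).
  rewrite leq_mul2l; apply/orP; right.
  apply: leq_trans (leq_card_setU _ _).1 _; rewrite leq_add2r.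
  exact: (leq_card_setU _ _).1.
rewrite !mulnDr; apply: leq_trans (leq_add (leq_add h1 h2) h3) _.
by rewrite /k; move: {h1 h2 h3}N => N; lia.
Qed.

(** * The limit *)

Lemma sqr_le_exp2 (L : nat) : (L.+1 ^ 2 <= 4 * 2 ^ L)%N.
Proof.
elim: L => // -[|[|L]] // IH; rewrite (expnS 2 L.+2).
by move: (2 ^ L.+2)%N IH => N; nia.
Qed.

Lemma sqr_trunc_log2 (n : nat) : (0 < n)%N -> ((trunc_log 2 n).+1 ^ 2 <= 4 * n)%N.
Proof.
move=> n0; apply: leq_trans (sqr_le_exp2 _) _; rewrite leq_mul2l /=.
by have /andP[] := trunc_log_bounds (isT : 1 < 2)%N n0.
Qed.

Lemma card_sgraph (T : finType) : #|{: sgraph T}| = (2 ^ #|vpairs T|)%N.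
Proof. by rewrite card_sig -card_powerset; apply: eq_card => E; rewrite !inE. Qed.

From mathcomp Require Import all_classical all_reals all_analysis.
Import numFieldNormedType.Exports.
Local Open Scope classical_set_scope.

Lemma gnp_prob_half (R : realType) (n : nat) (A : sgraph 'I_n -> Prop) :
  gnp_prob (2^-1 : R) A = #|[pred G | `[< A G >]]|%:R / (2 ^ #|vpairs 'I_n|)%:R.
Proof.
rewrite /gnp_prob -mulr_natl -sumr_const mulr_suml; apply: eq_bigr => G _.
rewrite /gnp_mass (eq_bigr (fun=> 2^-1)) => [|e _].
  by rewrite prodr_const exprVn natrX mul1r.
by case: ifP => // _; lra.
Qed.

(** The failure probability is of order [L.+1 / n], and [L.+1 ^ 2 <= 4 * n] turns this into order
    [1 / L.+1]. *)
Lemma gnp_prob_antimagic_dist (R : realType) (n : nat) (L := trunc_log 2 n) :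
    (200 * (9 * L).+2 <= n)%N ->
  `|1 - gnp_prob (2^-1 : R) (@antimagic_orientation 'I_n)| <= (4000 * (16 * 4))%:R / L.+1%:R.
Proof.
move=> nL; have [|bad [cbad badP]] := @card_not_antimagic 'I_n; first by rewrite card_ord.
rewrite card_ord -/L in cbad.
pose a := #|[pred G | `[< @antimagic_orientation 'I_n G >]]|.
pose c := #|[predC [pred G | `[< @antimagic_orientation 'I_n G >]]]|.
pose N := (2 ^ #|vpairs 'I_n|)%N.
have acN : (a + c = N)%N by rewrite cardC card_sgraph.
have cb : (c <= #|bad|)%N.
  rewrite /c -(card_imset _ val_inj); apply: subset_leq_card; apply/fintype.subsetP => _ /imsetP[G GA ->].
  by apply: contraT => Gb; move: GA; rewrite inE /= => /negP[]; apply/asboolP/badP.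
have N0 : (0 < N)%N by rewrite expn_gt0.
have n0 : (0 < n)%N by lia.
have -> : 1 - gnp_prob (2^-1 : R) (@antimagic_orientation 'I_n) = c%:R / N%:R.
  rewrite gnp_prob_half -/a -/N -acN natrD; field.
  by rewrite -natrD acN pnatr_eq0 -lt0n.
rewrite ger0_norm ?divr_ge0 // ler_pdivrMr ?ltr0n // mulrAC ler_pdivlMr ?ltr0n //.
rewrite -!natrM ler_nat -(@leq_pmul2l n) //.
have Ln : (L.+1 ^ 2 <= 4 * n)%N by apply: sqr_trunc_log2.
apply: (@leq_trans (4000 * (4 * L.+1) * N * L.+1)).
  rewrite mulnA leq_mul2r; apply/orP; right.
  by apply: leq_trans cbad; rewrite leq_mul2l cb orbT.
have : (L.+1 ^ 2 * N <= 4 * n * N)%N by rewrite leq_mul2r Ln orbT.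
lia.
Qed.

Theorem theorem2 (R : realType) :
  gnp_prob (2^-1 : R) (@antimagic_orientation 'I_n) @[n --> \oo] --> (1 : R).
Proof.
apply/cvgrPdist_le => e e0; pose q : R := (4000 * (16 * 4))%:R / e.
(* For [L] at least [4 * 1800], [L.+1 ^ 2 <= 4 * n] yields [1800 * L.+1 <= n], which implies the
   size condition; the other entry makes [L.+1] exceed [q]. *)
pose M := maxn (4 * 1800) (Num.truncn q).+1.
exists (2 ^ M)%N => // n /= Mn.
have n0 : (0 < n)%N by apply: leq_trans Mn; rewrite expn_gt0.
have ML : (M <= trunc_log 2 n)%N by apply: trunc_log_max.
set L := trunc_log 2 n in ML.
have Ln : (L.+1 ^ 2 <= 4 * n)%N by apply: sqr_trunc_log2.
apply: le_trans (gnp_prob_antimagic_dist _ _) _.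
  rewrite -/L; move: ML; rewrite geq_max => /andP[M1 _]; nia.
rewrite -/L ler_pdivrMr ?ltr0n // mulrC -ler_pdivrMr // -/q.
apply: (le_trans (ltW (truncnS_gt q))); rewrite ler_nat.
by move: ML; rewrite geq_max => /andP[_ /leqW].
Qed.
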